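(* Let $\phi=(\text{B-code})^{-1}\circ(\text{A-code}):\mathsf{G}_{r,n}\to\mathsf{G}_{r,n}$. For every $\pi\in\mathsf{G}_{r,n}$, $$\bigl(\ell,\mathsf{Rmil}^0,\mathsf{Rmil}^1,\dots,\mathsf{Rmil}^{r-1},\mathsf{Lmil}^0,\dots,\mathsf{Lmil}^{r-1},\mathsf{Lmal}^0,\dots,\mathsf{Lmal}^{r-1},\mathsf{Lmap}^0,\dots,\mathsf{Lmap}^{r-1}\bigr)(\pi)$$ equals $$\bigl(\mathsf{sor},\mathsf{Cyc}^0,\mathsf{Cyc}^{r-1},\dots,\mathsf{Cyc}^{1},\mathsf{Lmic}^0,\mathsf{Lmic}^{r-1},\dots,\mathsf{Lmic}^1,\mathsf{Lmal}^0,\mathsf{Lmal}^{r-1},\dots,\mathsf{Lmal}^1,\mathsf{Lmap}^0,\mathsf{Lmap}^{r-1},\dots,\mathsf{Lmap}^1\bigr)(\phi(\pi)),$$ i.e. $\ell(\pi)=\mathsf{sor}(\phi(\pi))$ and, for every $t\in\mathbb Z/r$, $\mathsf{Rmil}^t(\pi)=\mathsf{Cyc}^{-t}(\phi(\pi))$, $\mathsf{Lmil}^t(\pi)=\mathsf{Lmic}^{-t}(\phi(\pi))$, $\mathsf{Lmal}^t(\pi)=\mathsf{Lmal}^{-t}(\phi(\pi))$, $\mathsf{Lmap}^t(\pi)=\mathsf{Lmap}^{-t}(\phi(\pi))$.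
   Context: $\mathsf{G}_{r,n}=C_r\wr\mathfrak S_n$: pairs $(\sigma,\mathbf z)$, $\sigma\in\mathfrak S_n$, $\mathbf z\in(\mathbb Z/r)^n$, written $\pi=\sigma_1^{[z_1]}\cdots\sigma_n^{[z_n]}$ (colors in $\{0,\dots,r-1\}$, read mod $r$); product $(\sigma,\mathbf z)(\rho,\mathbf w)=(\sigma\rho,\mathbf w+\rho(\mathbf z))$, $\rho(\mathbf z)=(z_{\rho(1)},\dots,z_{\rho(n)})$; $\pi$ acts on $\{i^{[t]}\}$ by $\pi(i^{[t]})=\sigma_i^{[z_i+t]}$, and $i^{[0]}=i$. $\ell(\pi)$: minimal number of factors in an expression of $\pi$ as a product of $s_0=1^{[1]}2\cdots n$ and $s_i$ ($1\le i<n$; base permutation $(i\ i+1)$, colors $0$). For $1\le i<j$, right multiplication of a word $\tau_1^{[y_1]}\cdots\tau_j^{[y_j]}$ by $(i^{[t]}\,j)$ replaces the letter at position $j$ by $\tau_i^{[y_i+t]}$ and that at position $i$ by $\tau_j^{[y_j-t]}$. $\mathsf{CS}_{r,n}=\{(c_1^{[e_1]},\dots,c_n^{[e_n]}):1\le c_i\le i,\ 0\le e_i<r\}$. A-code: $\pi^{(n)}=\pi$; for $j=n,\dots,1$, if base value $j$ is at position $p$ of $\pi^{(j)}$ with color $t$, set $c_j=p,e_j=t$ and delete it to get $\pi^{(j-1)}$. B-code: $\pi^{(n)}=\pi$; for $j=n,\dots,1$, $c_j$ = position of base value $j$ in $\pi^{(j)}$, $z$ its color, $e_j\equiv-z\pmod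 r$; $\pi^{(j-1)}$ = first $j-1$ letters of $\pi^{(j)}\cdot(c_j^{[e_j]}\,j)$ if $c_j<j$, of $\pi^{(j)}$ if $c_j=j$. Both codes are bijections $\mathsf{G}_{r,n}\to\mathsf{CS}_{r,n}$. $\mathsf{sor}(\pi)=\sum_j\bigl(j-c_j+\chi(e_j>0)(2(c_j-1)+e_j)\bigr)$ with $(c_j^{[e_j]})=\text{B-code}(\pi)$ (total distance of the paper's sorting process), $\chi$ the indicator. Statistics: $\mathsf{Rmil}(\pi)=\{\sigma_i^{[z_i]}:\sigma_i<\sigma_j\,\forall j>i\}$, $\mathsf{Lmil}(\pi)=\{\sigma_i^{[z_i]}:\sigma_i<\sigma_j\,\forall j<i\}$, $\mathsf{Lmal}(\pi)=\{\sigma_i^{[z_i]}:\sigma_i>\sigma_j\,\forall j<i\}$, $\mathsf{Lmap}(\pi)=\{i^{[z_i]}:\sigma_i>\sigma_j\,\forall j<i\}$; $\mathsf{Cyc}(\pi)$ = set of $\alpha^{[c]}$ over cycles of $\sigma$ with element set $B$, $\alpha=\min B$, $c\equiv\sum_{k\in B}z_k$; $\mathsf{Lmic}(\pi)$ = set of letters of the word $\pi(1)\pi^2(1)\cdots\pi^m(1)$ ($m\ge1$ least with $\pi^m(1)=1$) whose base value is smaller than those of all earlier letters. For a set $S$ of colored letters, $S^t=\{k:k^{[t]}\in S\}$. *)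

(* Defs.v *)
From mathcomp Require Import all_boot.
Set Implicit Arguments. Unset Strict Implicit. Unset Printing Implicit Defensive.

(* A letter sigma_i^[z_i] is the pair (sigma_i, z_i); base values are 1..n,
   colors are in {0,..,r-1}.  An element pi of G_{r,n} is the word
   [:: (sigma_1,z_1); ...; (sigma_n,z_n)]. *)
Definition letter := (nat * nat)%type.
Definition word := seq letter.

Definition lt_at (w : word) (k : nat) : letter := nth (0, 0) w k.-1.

Definition isG (r n : nat) (w : word) : bool :=
  [&& size w == n, perm_eq (map fst w) (iota 1 n) & all (fun l => l.2 < r) w].

(* product (sigma,z)(rho,w) = (sigma rho, w + rho(z)) *)
Definition mulG (r : nat) (p q : word) : word :=
  [seq let l := lt_at p x.1 in (l.1, (x.2 + l.2) %% r) | x <- q].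

Definition idG (n : nat) : word := [seq (k, 0) | k <- iota 1 n].

Definition s0 (r n : nat) : word := (1, 1 %% r) :: [seq (k, 0) | k <- iota 2 n.-1].
Definition si (n i : nat) : word :=
  [seq (if k == i then i.+1 else if k == i.+1 then i else k, 0) | k <- iota 1 n].
Definition gens (r n : nat) : seq word :=
  if n is 0 then [::] else s0 r n :: [seq si n i | i <- iota 1 n.-1].

Definition prodG (r n : nat) (ws : seq word) : word := foldr (mulG r) (idG n) ws.

Definition is_length (r n : nat) (pi : word) (k : nat) : Prop :=
  (exists ws : seq word, all (fun g => g \in gens r n) ws /\ size ws = k /\ prodG r n ws = pi)
  /\ (forall ws : seq word, all (fun g => g \in gens r n) ws -> prodG r n ws = pi -> k <= size ws).

Fixpoint acode_aux (j : nat) (w : word) : seq (nat * nat) :=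
  match j with
  | 0 => [::]
  | j'.+1 =>
      let p := index j (map fst w) in
      rcons (acode_aux j' (take p w ++ drop p.+1 w)) (p.+1, (nth (0, 0) w p).2)
  end.
Definition acode (w : word) := acode_aux (size w) w.

(* right multiplication of the word w by (i^[t] j), i < j *)
Definition rtrans (r : nat) (w : word) (i t j : nat) : word :=
  [seq if k == j then ((lt_at w i).1, ((lt_at w i).2 + t) %% r)
       else if k == i then ((lt_at w j).1, ((lt_at w j).2 + (r - t %% r)) %% r)
       else lt_at w k | k <- iota 1 (size w)].

Fixpoint bcode_aux (r j : nat) (w : word) : seq (nat * nat) :=
  match j with
  | 0 => [::]
  | j'.+1 =>
      let p := index j (map fst w) in
      let c := p.+1 in
      let z := (nth (0, 0) w p).2 in
      let e := (r - z) %% r in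
      let w' := if c < j then take j' (rtrans r w c e j) else take j' w in
      rcons (bcode_aux r j' w') (c, e)
  end.
Definition bcode (r : nat) (w : word) := bcode_aux r (size w) w.

Fixpoint colorvecs (r n : nat) : seq (seq nat) :=
  if n is n'.+1 then [seq c :: v | c <- iota 0 r, v <- colorvecs r n'] else [:: [::]].
Definition Gelems (r n : nat) : seq word :=
  [seq zip p v | p <- permutations (iota 1 n), v <- colorvecs r n].
Definition phi (r n : nat) (pi : word) : word :=
  nth [::] (Gelems r n) (find (fun rho => bcode r rho == acode pi) (Gelems r n)).

Definition sor (r : nat) (w : word) : nat :=
  sumn [seq let j := x.1 in let c := x.2.1 in let e := x.2.2 in
            j - c + (0 < e) * (2 * (c - 1) + e)
       | x <- zip (iota 1 (size w)) (bcode r w)].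

Definition negc (r t : nat) : nat := (r - t) %% r.

Definition Rmil (w : word) (t : nat) : seq nat :=
  [seq (lt_at w i).1 | i <- iota 1 (size w) &
     all (fun j => (lt_at w i).1 < (lt_at w j).1) (iota i.+1 (size w - i))
     && ((lt_at w i).2 == t)].
Definition Lmil (w : word) (t : nat) : seq nat :=
  [seq (lt_at w i).1 | i <- iota 1 (size w) &
     all (fun j => (lt_at w i).1 < (lt_at w j).1) (iota 1 i.-1)
     && ((lt_at w i).2 == t)].
Definition Lmal (w : word) (t : nat) : seq nat :=
  [seq (lt_at w i).1 | i <- iota 1 (size w) &
     all (fun j => (lt_at w j).1 < (lt_at w i).1) (iota 1 i.-1)
     && ((lt_at w i).2 == t)].
Definition Lmap (w : word) (t : nat) : seq nat :=
  [seq i | i <- iota 1 (size w) &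
     all (fun j => (lt_at w j).1 < (lt_at w i).1) (iota 1 i.-1)
     && ((lt_at w i).2 == t)].

Definition cycle_of (w : word) (a : nat) : seq nat :=
  undup (traject (fun k => (lt_at w k).1) a (size w)).
Definition Cyc (r : nat) (w : word) (t : nat) : seq nat :=
  [seq a <- iota 1 (size w) |
     all (fun k => a <= k) (cycle_of w a)
     && ((sumn [seq (lt_at w k).2 | k <- cycle_of w a]) %% r == t)].

(* Lmic^t: action pi(i^[t]) = sigma_i^[z_i + t]; the word pi(1) pi^2(1) ... pi^m(1) *)
Definition actG (r : nat) (w : word) (x : letter) : letter :=
  ((lt_at w x.1).1, ((lt_at w x.1).2 + x.2) %% r).
Definition orbit1 (r : nat) (w : word) : seq letter :=
  let L := [seq iter k.+1 (actG r w) (1, 0) | k <- iota 0 (size w * r)] in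
  take (index (1, 0) L).+1 L.
Definition Lmic (r : nat) (w : word) (t : nat) : seq nat :=
  let o := orbit1 r w in
  [seq (nth (0, 0) o k).1 | k <- iota 0 (size o) &
     all (fun y => (nth (0, 0) o k).1 < y.1) (take k o)
     && ((nth (0, 0) o k).2 == t)].

(* Main.v *)
Require Import Defs.
From mathcomp Require Import all_boot.
From mathcomp Require Import zify.

(* Both codes are read off by repeatedly removing the largest base value, so
   every statistic is compared through one insertion step.  On the A-code side,
   n+1 is inserted at position p of a word and the later letters move right; on
   the B-code side, n+1 takes position p and the displaced letter goes to the
   end, which inserts n+1 in the cycle of p, just after p.  On both sides the
   letters before p are untouched and those after p are not left-to-right
   maxima; n+1 becomes a right-to-left minimum, resp. a cycle minimum, iff
   p = n+1, and a left-to-right minimum, resp. an element of Lmic, iff p = 1.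
   For the length, the cost of the A-code increases by at most one under right
   multiplication by a generator, and every element of nonzero cost is reached
   from an element of cost one less; both facts follow by locating n+1. *)

Set Implicit Arguments. Unset Strict Implicit. Unset Printing Implicit Defensive.

(** * Insertion steps of the two codes *)

Lemma iota_rcons m n : iota m n.+1 = rcons (iota m n) (m + n).
Proof. by rewrite -addn1 iotaD cats1. Qed.

Lemma mem_bases r n w a : isG r n w -> (a \in map fst w) = (0 < a <= n).
Proof. by case/and3P=> _ /perm_mem/(_ a) -> _; rewrite mem_iota add1n ltnS. Qed.

Lemma isG_size r n w : isG r n w -> size w = n.
Proof. by case/and3P=> /eqP. Qed.

Lemma isG_perm r n w1 w2 :
  perm_eq (map fst w1) (map fst w2) -> all (fun l => l.2 < r) w2 ->
  isG r n w1 -> isG r n w2.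
Proof.
move=> pw cw /and3P[/eqP sw bw _]; apply/and3P; split => //.
  by rewrite -sw -(size_map fst w1) (perm_size pw) size_map.
by apply: perm_trans bw; rewrite perm_sym.
Qed.

(** Up to permutation the base value n+1 can be brought to the front, and it is the last entry of
    [iota 1 n.+1], so it cancels on both sides. *)
Lemma isG_insert r n e u v :
  isG r n.+1 (u ++ (n.+1, e) :: v) = (e < r) && isG r n (u ++ v).
Proof.
rewrite /isG !size_cat /= addnS eqSS all_cat /= [in RHS]all_cat.
rewrite map_cat /= -cat1s perm_catCA /= -/(iota 1 n.+1) iota_rcons add1n.
by rewrite perm_sym perm_rcons perm_cons perm_sym map_cat; case: (e < r); rewrite //= !andbF.
Qed.

Lemma isG_splitP r n w : isG r n.+1 w ->
  exists u e v, [/\ w = u ++ (n.+1, e) :: v, e < r & isG r n (u ++ v)].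
Proof.
move=> Gw; have: n.+1 \in map fst w by rewrite (mem_bases _ Gw) ltnSn.
case/mapP=> -[a e] /splitPr sw /= ea; rewrite -{}ea in sw *.
case: sw Gw => u v; rewrite isG_insert => /andP[? ?].
by exists u, e, v.
Qed.

Lemma isG_ltn r n w : isG r n w -> all (fun x => 0 < x.1 <= n) w.
Proof.
by move=> Gw; apply/allP=> x xw; rewrite -(mem_bases _ Gw) map_f.
Qed.

Lemma isG_color r n w : isG r n w -> all (fun x => x.2 < r) w.
Proof. by case/and3P. Qed.

Lemma index_insert r n e u v : isG r n (u ++ v) ->
  index n.+1 (map fst (u ++ (n.+1, e) :: v)) = size u.
Proof.
move=> Guv; rewrite map_cat index_cat /= eqxx addn0 size_map ifN //.
apply/mapP=> -[x xu Dx]; have /allP/(_ x) := isG_ltn Guv.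
by rewrite mem_cat xu -Dx ltnn => /(_ isT).
Qed.

Lemma acode_insert r n e u v : isG r n (u ++ v) ->
  acode (u ++ (n.+1, e) :: v) = rcons (acode (u ++ v)) ((size u).+1, e).
Proof.
move=> Guv; have := isG_size Guv; rewrite /acode !size_cat addnS => ->.
rewrite [acode_aux n.+1 _]/= (index_insert _ Guv) take_size_cat // nth_cat ltnn subnn /=.
by rewrite drop_cat ltnNge leqnSn /= subSnn drop1.
Qed.

Lemma lt_at_cat u v k : lt_at (u ++ v) k.+1 = if k < size u then lt_at u k.+1 else lt_at v (k - size u).+1.
Proof. by rewrite /lt_at /= nth_cat. Qed.

Lemma negcK r e : e < r -> negc r (negc r e) = e.
Proof.
rewrite /negc => er; case: e er => [|e] er.
  by rewrite subn0 modnn subn0 modnn.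
rewrite (modn_small (m := r - e.+1)) ?ltn_subrL /=; last by lia.
by rewrite subKn ?modn_small // ltnW.
Qed.

Lemma negc_lt r e : 0 < r -> negc r e < r.
Proof. exact: ltn_pmod. Qed.

Lemma eq_negc r e t : e < r -> t < r -> (negc r e == negc r t) = (e == t).
Proof.
by move=> er tr; apply/eqP/eqP=> [E|->//]; rewrite -(negcK er) E negcK.
Qed.

(* One step of the inverse of the B-code: the letter x at the 0-based position
   p (if any) is sent to the new last position, and n+1 takes its place. *)
Definition bins (r p e : nat) (w : word) : word :=
  take p w ++ ((size w).+1, negc r e) ::
  (if drop p w is x :: v then rcons v (x.1, (x.2 + e) %% r) else [::]).

Lemma bins_size r e u : bins r (size u) e u = rcons u ((size u).+1, negc r e).
Proof. by rewrite /bins take_size drop_size cats1. Qed.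

Lemma bins_cat r e u x v : bins r (size u) e (u ++ x :: v) =
  u ++ ((size u + size v).+2, negc r e) :: rcons v (x.1, (x.2 + e) %% r).
Proof. by rewrite /bins take_size_cat // drop_size_cat // size_cat /= addnS. Qed.

Lemma size_bins r p e w : p <= size w -> size (bins r p e w) = (size w).+1.
Proof.
move=> pw; rewrite -{2}(cat_take_drop p w) !size_cat /=.
by case: (drop p w) => [|x v] /=; rewrite ?size_rcons ?addnS ?addn0.
Qed.

Lemma isG_bins r n p e w : 0 < r -> p <= n -> isG r n w -> isG r n.+1 (bins r p e w).
Proof.
move=> r0 pn Gw; rewrite /bins (isG_size Gw) isG_insert negc_lt //=.
case E: (drop p w) => [|x v].
  by rewrite cats0 -[take p w]cats0 -E cat_take_drop.
move: Gw; rewrite -{1}(cat_take_drop p w) E => Gw.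
apply: isG_perm (Gw).
  by rewrite !map_cat /= map_rcons perm_cat2l perm_sym perm_rcons.
have := isG_color Gw; rewrite !all_cat /= all_rcons /= ltn_pmod //.
by case/and3P=> -> _ ->.
Qed.

(** If n+1, of color z, is not last, the final letter is put back in its place with z added to its
    color; the code entry e is the negative of z. *)
Lemma isG_binsP r n w : 0 < r -> isG r n.+1 w ->
  exists p e w', [/\ p <= n, e < r, isG r n w' & w = bins r p e w'].
Proof.
move=> r0 /isG_splitP[u [z [v [-> zr Guv]]]]; case/lastP: v Guv => [|v [b y]] Guv.
  rewrite cats0 in Guv; exists n, (negc r z), u; split=> //; first exact: negc_lt.
  by rewrite -{2}(isG_size Guv) bins_size negcK // (isG_size Guv) cats1.
have su := isG_size Guv; rewrite size_cat size_rcons addnS in su.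
have := isG_color Guv; rewrite all_cat all_rcons => /and3P[cu yr cv].
exists (size u), (negc r z), (u ++ (b, (y + z) %% r) :: v); split.
- by rewrite -su leqW // leq_addr.
- exact: negc_lt.
- apply: isG_perm Guv; last by rewrite all_cat /= cu cv ltn_pmod.
  by rewrite !map_cat /= map_rcons perm_cat2l perm_rcons.
rewrite bins_cat su negcK //= /negc.
congr (_ ++ _ :: rcons _ (_, _)).
rewrite modnDm -addnA subnKC ?(ltnW zr) // modnDr modn_small //.
Qed.

Lemma lt_at_rtrans r w i t j k : k < size w -> lt_at (rtrans r w i t j) k.+1 =
  if k.+1 == j then ((lt_at w i).1, ((lt_at w i).2 + t) %% r)
       else if k.+1 == i then ((lt_at w j).1, ((lt_at w j).2 + (r - t %% r)) %% r)
       else lt_at w k.+1.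
Proof.
by move=> kw; rewrite {1}/lt_at (nth_map 0) ?size_iota // nth_iota // add1n.
Qed.

Lemma lt_at_bins_p r n p e w : isG r n w -> p <= n ->
  lt_at (bins r p e w) p.+1 = (n.+1, negc r e).
Proof.
move=> Gw pn; rewrite lt_at_cat size_takel ?(isG_size Gw) // ltnn subnn.
by rewrite /lt_at /=.
Qed.

Lemma lt_at_bins_last r n p e w : isG r n w -> p < n ->
  lt_at (bins r p e w) n.+1 = ((lt_at w p.+1).1, ((lt_at w p.+1).2 + e) %% r).
Proof.
move=> Gw pn; have sw := isG_size Gw.
rewrite lt_at_cat size_takel ?sw ?(ltnW pn) // ltnNge (ltnW pn) /=.
rewrite (drop_nth (0, 0)) ?sw // /lt_at /= -[n - p]prednK ?subn_gt0 //= nth_rcons.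
by rewrite size_drop sw subnS ltnn eqxx.
Qed.

Lemma lt_at_bins r n p e w k : isG r n w -> k < n -> k != p ->
  lt_at (bins r p e w) k.+1 = lt_at w k.+1.
Proof.
move=> Gw kn kp; have sw := isG_size Gw.
have [pn|np] := ltnP p n; last first.
  have kp' := leq_trans kn np.
  by rewrite lt_at_cat size_take_min sw leq_min kp' kn /lt_at /= nth_take.
rewrite lt_at_cat size_takel ?sw ?(ltnW pn) //.
case: ltngtP kp => // kp _; first by rewrite /lt_at /= nth_take.
rewrite (drop_nth (0, 0)) ?sw // /lt_at /= -[k - p]prednK ?subn_gt0 //= nth_rcons.
rewrite size_drop sw ifT; last by lia.
by rewrite nth_drop; congr nth; lia.
Qed.

(** The multiplication [rtrans] in the B-code returns the final letter to its old place and
    subtracts the e that [bins] added to its color. *)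
Lemma bcode_bins r n p e w : 0 < r -> p <= n -> e < r -> isG r n w ->
  bcode r (bins r p e w) = rcons (bcode r w) (p.+1, e).
Proof.
move=> r0 pn er Gw; have sw := isG_size Gw.
have sb : size (bins r p e w) = n.+1 by rewrite size_bins sw.
rewrite /bcode sb sw [bcode_aux r n.+1 _]/=.
have -> : index n.+1 (map fst (bins r p e w)) = p.
  have := isG_bins e r0 pn Gw; rewrite /bins sw isG_insert => /andP[_ G'].
  by rewrite (index_insert _ G') size_takel // sw.
rewrite -[nth _ _ p]/(lt_at _ p.+1) (lt_at_bins_p _ Gw pn) /= -/(negc r _) negcK //.
congr (rcons (bcode_aux r n _) _); rewrite ltnS.
(* If p = n, no letter was displaced and n+1 stands at the end. *)
case: ltnP => [pn'|np]; last first.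
  by rewrite /bins take_cat size_takel ?sw // ltnNge pn (eqP (_ : n - p == 0)) ?subn_eq0 //= cats0 take_oversize // sw.
apply: (@eq_from_nth _ (0, 0)) => [|k].
  by rewrite size_takel ?sw // size_map size_iota sb.
rewrite size_takel ?size_map ?size_iota ?sb // => kn.
rewrite nth_take // -[nth _ _ k]/(lt_at _ k.+1) lt_at_rtrans ?sb ?(leqW kn) //.
rewrite eqSS (ltn_eqF kn) eqSS; case: eqP => [->|/eqP kp]; last exact: (lt_at_bins _ Gw).
rewrite (lt_at_bins_last _ Gw) //= (modn_small er) modnDml -addnA subnKC ?(ltnW er) //.
rewrite modnDr modn_small; first by rewrite /lt_at; case: nth.
by have /(all_nthP (0, 0))/(_ p) := isG_color Gw; rewrite sw; apply.
Qed.

(** Equal codes have equal last entries, so both words arise by inserting n+1 with the same p and e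
    into shorter words whose codes agree again. The comparisons of the set-valued statistics rest on
    this induction. *)
Lemma acode_bcode_ind (r : nat) (P : nat -> word -> word -> Prop) : 0 < r ->
  P 0 [::] [::] ->
  (forall n e u v w, isG r n (u ++ v) -> isG r n w -> e < r -> acode (u ++ v) = bcode r w ->
     P n (u ++ v) w -> P n.+1 (u ++ (n.+1, e) :: v) (bins r (size u) e w)) ->
  forall n w1 w2, isG r n w1 -> isG r n w2 -> acode w1 = bcode r w2 -> P n w1 w2.
Proof.
move=> r0 P0 PS; elim=> [|n IH] w1 w2.
  by move=> /isG_size/size0nil-> /isG_size/size0nil->.
move=> /isG_splitP[u [e [v [-> er G1]]]] /(isG_binsP r0)[p [e' [w [pn e'r G2 ->]]]].
rewrite (acode_insert _ G1) (bcode_bins r0 pn e'r G2) => /rcons_inj[E <- <-].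
by apply: PS => //; apply: IH.
Qed.

(** Since [phi] is a search, it must be shown to succeed: a preimage is assembled by one [bins] step
    for each entry of the A-code. *)
Lemma bcode_surj r n w1 : 0 < r -> isG r n w1 ->
  exists2 w2, isG r n w2 & bcode r w2 = acode w1.
Proof.
move=> r0; elim: n w1 => [|n IH] w1 G1.
  by exists w1 => //; rewrite (size0nil (isG_size G1)).
case/isG_splitP: G1 => u [e [v [-> er G1]]].
have [w G2 E] := IH _ G1; have := isG_size G1; rewrite size_cat => suv.
have un : size u <= n by rewrite -suv leq_addr.
exists (bins r (size u) e w); first exact: isG_bins.
by rewrite (acode_insert _ G1) (bcode_bins r0 un er G2) E.
Qed.

(** * Enumeration of the group and the map phi *)

Lemma mem_colorvecs r n v : (v \in colorvecs r n) = (size v == n) && all (fun z => z < r) v.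
Proof.
elim: n v => [|n IH] [|c v] //=.
  by apply/negbTE/negP=> /allpairsP[[? ?] []].
apply/allpairsP/idP=> [[[c' v'] /= [+ + [-> ->]]]|].
  by rewrite mem_iota IH add0n /= eqSS => -> /andP[-> ->].
rewrite eqSS => /and3P[sv cr cv]; exists (c, v).
by rewrite mem_iota IH sv cr.
Qed.

Lemma mem_Gelems r n w : (w \in Gelems r n) = isG r n w.
Proof.
apply/allpairsP/idP=> [[[p v] /= []]|Gw].
  rewrite mem_permutations mem_colorvecs => pp /andP[/eqP sv cv] ->.
  have sp : size p = n by rewrite (perm_size pp) size_iota.
  rewrite /isG -/unzip1 unzip1_zip ?sp ?sv // size_zip sp sv minnn eqxx pp /=.
  by rewrite -(all_map snd (fun z => z < r)) -/unzip2 unzip2_zip ?sp ?sv.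
exists (unzip1 w, unzip2 w); rewrite zip_unzip mem_permutations mem_colorvecs.
by case/and3P: Gw => /eqP sw pw cw; rewrite size_map sw eqxx all_map.
Qed.

Lemma phiP r n w : 0 < r -> isG r n w ->
  isG r n (phi r n w) /\ acode w = bcode r (phi r n w).
Proof.
move=> r0 Gw; have hasw : has (fun w' => bcode r w' == acode w) (Gelems r n).
  have [w' Gw' E] := bcode_surj r0 Gw.
  by apply/hasP; exists w'; rewrite ?mem_Gelems ?E.
split; last by symmetry; apply/eqP/(nth_find [::] hasw).
by rewrite -mem_Gelems mem_nth // -has_find.
Qed.

(** * Left-to-right minima and maxima *)

Lemma map_lt_at w k m : k + m <= size w ->
  [seq lt_at w j | j <- iota k.+1 m] = take m (drop k w).
Proof.
move=> km; apply: (@eq_from_nth _ (0, 0)) => [|i].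
  by rewrite size_map size_iota size_takel // size_drop leq_subRL ?(leq_trans (leq_addr _ _) km).
rewrite size_map size_iota => im.
by rewrite (nth_map 0) ?size_iota // nth_iota // nth_take // nth_drop /lt_at addSn.
Qed.

Lemma all_lt_at (P : pred letter) w k m : k + m <= size w ->
  all (fun j => P (lt_at w j)) (iota k.+1 m) = all P (take m (drop k w)).
Proof. by move=> km; rewrite -map_lt_at // all_map. Qed.

(** The letter x is a strict left-to-right minimum of w. Repeated letters are allowed in w, so that
    the notion serves words and walks along a cycle alike. *)
Fixpoint lmin (x : letter) (w : word) : bool :=
  if w is y :: w' then (y == x) || (x.1 < y.1) && lmin x w' else false.

Lemma lmin_cat x u v :
  lmin x (u ++ v) = lmin x u || all (fun y => x.1 < y.1) u && lmin x v.
Proof. by elim: u => //= y u ->; case: eqP => //= _; case: ltnP. Qed.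

Lemma lmin_mem x w : lmin x w -> x \in w.
Proof.
elim: w => //= y w IH; rewrite in_cons eq_sym.
by case: eqP => //= _ /andP[_ /IH].
Qed.

Lemma lminP x w :
  reflect (exists2 k, k < size w & nth (0, 0) w k = x /\ all (fun y => x.1 < y.1) (take k w))
          (lmin x w).
Proof.
elim: w => [|y w IH] /=; first by right=> -[].
apply: (iffP orP) => [[/eqP->|/andP[xy /IH[k kw [kx ak]]]]|].
- by exists 0.
- by exists k.+1 => //=; rewrite xy.
case=> -[|k] /= kw [kx]; first by left; apply/eqP.
by case/andP=> xy ak; right; rewrite xy; apply/IH; exists k.
Qed.

Lemma mem_Lmil w a t : (a \in Lmil w t) = lmin (a, t) w.
Proof.
apply/mapP/lminP=> [[i]|[k kw [kx ak]]].
  rewrite mem_filter mem_iota add1n => /andP[/andP[+ /eqP <-]]; case: i => // i + /= iw ->; rewrite ltnS in iw.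
  rewrite (all_lt_at (fun y => _ < y.1)) ?drop0 /= => [ai|]; last exact: ltnW.
  by exists i => //; split=> //; rewrite /lt_at /=; case: (nth _ w i).
exists k.+1; last by rewrite /lt_at /= kx.
rewrite mem_filter mem_iota /lt_at /= kx /= eqxx andbT -/(lt_at w) add1n ltnS kw andbT.
by rewrite (all_lt_at (fun y => a < y.1)) ?drop0 //= ltnW.
Qed.

Lemma mem_Rmil w a t : (a \in Rmil w t) = lmin (a, t) (rev w).
Proof.
apply/mapP/lminP=> [[i]|[k]].
  rewrite mem_filter mem_iota add1n => /andP[/andP[+ /eqP <-]]; case: i => // i + /= iw ->; rewrite ltnS in iw.
  rewrite (all_lt_at (fun y => _ < y.1)) ?subnKC // take_oversize ?size_drop // => ai.
  (* The 0-based position i of w is position [size w - i.+1] of the reversed word. *)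
  exists (size w - i.+1); first by rewrite size_rev ltn_subrL (leq_ltn_trans _ iw).
  rewrite nth_rev ?take_rev ?all_rev; last by rewrite ltn_subrL (leq_ltn_trans _ iw).
  rewrite subnSK // (subKn iw) (subKn (ltnW iw)); split=> //.
  by rewrite /lt_at /=; case: (nth _ w i).
rewrite size_rev => kw; rewrite nth_rev // take_rev all_rev => -[kx ak].
exists (size w - k); last by rewrite /lt_at -subnS kx.
rewrite mem_filter mem_iota /lt_at -subnS kx /= eqxx andbT -/(lt_at w).
rewrite (all_lt_at (fun y => a < y.1)) ?subnKC ?leq_subr // take_oversize ?size_drop // ak.
by rewrite subn_gt0 kw add1n ltnS leq_subr.
Qed.

Lemma lmin_gt n a t w : all (fun y => y.1 <= n) w -> n < a -> lmin (a, t) w = false.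
Proof.
by move=> wn na; apply/negP=> /lmin_mem/(allP wn) /=; rewrite leqNgt na.
Qed.

(** A letter larger than all others never blocks a minimum, and is a minimum itself only at the
    front. *)
Lemma lmin_insert n e u v a t : all (fun x => x.1 <= n) (u ++ v) ->
  lmin (a, t) (u ++ (n.+1, e) :: v) =
  if a == n.+1 then nilp u && (t == e) else lmin (a, t) (u ++ v).
Proof.
rewrite all_cat => /andP[un vn]; rewrite !lmin_cat /= [(_, _) == _]xpair_eqE.
case: ltngtP => [an|na|->]; rewrite ?eqxx /= ?andbF ?orbF ?[_ == t]eq_sym //.
  by rewrite (lmin_gt _ un) ?(lmin_gt _ vn) ?andbF // ltnW.
rewrite (lmin_gt _ un) //=; congr (_ && _); case: u un => //= y u /andP[yn _].
by rewrite ltnNge leqW.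
Qed.

(** The position is kept along with the letter, so that one comparison settles both [Lmal] and
    [Lmap]. *)
Definition lmax (w : word) (i : nat) (x : letter) : bool :=
  [&& i < size w, nth (0, 0) w i == x & all (fun y => y.1 < x.1) (take i w)].

Lemma lmax_take w p i x : p <= size w -> lmax (take p w) i x = (i < p) && lmax w i x.
Proof.
move=> pw; rewrite /lmax size_takel //; case: ltnP => //= ip.
by rewrite nth_take // take_takel ?(ltnW ip) // (leq_trans ip).
Qed.

(** No letter of v exceeds y, so v contributes no maximum. This makes the two insertions comparable
    although they treat the letters after n+1 differently. *)
Lemma lmax_insert u y v i x : all (fun z => z.1 < y.1) u -> all (fun z => z.1 <= y.1) v ->
  lmax (u ++ y :: v) i x = lmax u i x || (i == size u) && (x == y).
Proof.
move=> uy vy; rewrite /lmax size_cat /= nth_cat take_cat.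
case: (ltngtP i (size u)) => [iu|ui|->] /=.
- by rewrite orbF (leq_trans iu) ?leq_addr.
- rewrite all_cat -[i - size u]prednK ?subn_gt0 //= -subnS.
  case: (ltnP i) => //= iv; apply/negbTE/negP=> /and4P[/eqP <- _].
  by rewrite ltnNge => /negP[]; apply: (allP vy); apply: mem_nth; rewrite ltn_subLR // addSnnS.
rewrite subnn take0 cats0 /= eq_sym addnS leq_addr /=.
by case: eqP => // ->; rewrite uy.
Qed.

Lemma mem_Lmal w a t : reflect (exists i, lmax w i (a, t)) (a \in Lmal w t).
Proof.
apply: (iffP mapP) => [[i]|[k /and3P[kw /eqP kx ak]]].
  rewrite mem_filter mem_iota add1n => /andP[/andP[+ /eqP <-]]; case: i => // i + /= iw ->; rewrite ltnS in iw.
  rewrite (all_lt_at (fun y => y.1 < _)) ?drop0 /= => [ai|]; last exact: ltnW.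
  exists i; rewrite /lmax (_ : i < _) //= ai andbT /lt_at /=; case: nth => //.
exists k.+1; last by rewrite /lt_at /= kx.
rewrite mem_filter mem_iota /lt_at /= kx /= eqxx andbT -/(lt_at w) add1n ltnS kw andbT.
by rewrite (all_lt_at (fun y => y.1 < a)) ?drop0 //= ltnW.
Qed.

Lemma mem_Lmap w i t : reflect (exists a, 0 < i /\ lmax w i.-1 (a, t)) (i \in Lmap w t).
Proof.
rewrite /Lmap map_id mem_filter mem_iota; case: i => [|i].
  by rewrite ltnn andbF; right => -[? []].
rewrite /= add1n [i.+1 < _]ltnS; case: (ltnP i (size w)) => iw; last first.
  by rewrite andbF; right=> -[a [_ /and3P[]]]; rewrite ltnNge iw.
rewrite andbT (all_lt_at (fun y => y.1 < _)) ?drop0 ?(ltnW iw) //.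
apply: (iffP andP) => [[ai /eqP <-]|[a [_ /and3P[_ /eqP kx ak]]]].
  by exists (lt_at w i.+1).1; rewrite /lmax iw ai andbT /lt_at /=; case: (nth _ w i).
by rewrite /lt_at /= kx.
Qed.

Lemma isG_le r n w : isG r n w -> all (fun x => x.1 <= n) w.
Proof. by move/isG_ltn; apply: sub_all => x /andP[]. Qed.

Lemma lmax_bcode r n w1 w2 i a t : 0 < r -> t < r ->
  isG r n w1 -> isG r n w2 -> acode w1 = bcode r w2 ->
  lmax w1 i (a, t) = lmax w2 i (a, negc r t).
Proof.
move=> r0 tr G1 G2 E; move: i; move: n w1 w2 G1 G2 E.
apply: (acode_bcode_ind r0) => // n e u v w G1 G2 er _ IH i.
have pn : size u <= n by rewrite -(isG_size G1) size_cat leq_addr.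
have lt_uv := isG_le G1; rewrite all_cat in lt_uv; case/andP: lt_uv => lu lv.
rewrite lmax_insert; [|exact: lu|by apply: sub_all lv => x /leqW].
have Gb := isG_bins e r0 pn G2; move: (isG_le Gb); rewrite /bins (isG_size G2) all_cat => /and3P[_ _ lb].
rewrite lmax_insert //; last first.
  by apply/allP=> x /mem_take; move/(allP (isG_le G2)).
have su : size u <= size (u ++ v) by rewrite size_cat leq_addr.
(* The first p letters are unchanged on either side, so the induction hypothesis is restricted to
   these prefixes. *)
rewrite -[X in lmax X](take_size_cat v (erefl (size u))) lmax_take // lmax_take ?(isG_size G2) //.
by rewrite IH size_takel ?(isG_size G2) // !xpair_eqE eq_negc.
Qed.

(** * Cycle minima *)

Definition base (w : word) (k : nat) : nat := (lt_at w k).1.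

(** The map g follows f along the cycle, except for a detour from x through m. *)
Lemma fcycle_insert (T : eqType) (f g : T -> T) x m s :
  fcycle f (x :: s) -> {in s, g =1 f} -> x \notin s -> g x = m -> g m = f x ->
  fcycle g [:: x, m & s].
Proof.
case: s => [|y s] /=; first by rewrite andbT => /eqP fx _ _ -> ->; rewrite fx !eqxx.
rewrite !rcons_path => /and3P[/eqP fx py fl] gf xs -> ->.
rewrite fx !eqxx /= gf ?mem_last // [f _ == x]fl andbT /=.
rewrite (@eq_in_path _ [in y :: s] _ (frel f)) ?allss // => a b ain _ /=.
by rewrite gf.
Qed.

(** Starting from a, the cycle s is traversed within [size w] steps, so the trajectory of that
    length has exactly the elements of s. *)
Lemma cycle_of_perm w a s : fcycle (base w) s -> uniq s -> a \in s -> size s <= size w ->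
  perm_eq (cycle_of w a) s.
Proof.
move=> cs us ain ss; have [i s' Ds] := rot_to ain.
rewrite perm_sym -(perm_rot i) perm_sym; move: us cs ss; rewrite -(rot_uniq i) -(rot_cycle i) -(size_rot i) Ds {i s Ds ain}.
move=> us cs ss; apply: uniq_perm; rewrite ?undup_uniq // => x; rewrite mem_undup.
have cl y : y \in a :: s' -> base w y \in a :: s'.
  by move=> yi; rewrite (eqP (next_cycle cs yi)) mem_next.
apply/trajectP/idP=> [[k _ ->]|].
  by elim: k => [|k IH]; [exact: mem_head | exact: cl].
have -> : a :: s' = traject (base w) a (size s').+1.
  move: cs; rewrite /= => /fpathP[k Ek]; have := congr1 size Ek.
  rewrite size_rcons size_traject => Ek'; rewrite -Ek' trajectSr in Ek.
  by case/rcons_inj: Ek => <-.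
by case/trajectP=> k ks ->; exists k => //; apply: leq_trans ss.
Qed.

(** A cycle of the base permutation listed without repetition from any starting point; minima and
    color sums can be read off such a list instead of [cycle_of]. *)
Definition ucyc n (w : word) s :=
  [&& fcycle (base w) s, uniq s & all (fun k => 0 < k <= n) s].

Lemma ucyc_size n w s : ucyc n w s -> size s <= n.
Proof.
case/and3P=> _ us /allP bs; rewrite -(size_iota 1 n); apply: uniq_leq_size => // x /bs.
by rewrite mem_iota add1n ltnS.
Qed.

Lemma mem_Cyc r n w s a t : isG r n w -> ucyc n w s -> a \in s ->
  (a \in Cyc r w t) =
  all (fun k => a <= k) s && ((sumn [seq (lt_at w k).2 | k <- s]) %% r == t).
Proof.
move=> Gw us ain; have ss := ucyc_size us; case/and3P: us => cs us /allP/(_ a ain) an.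
have pe : perm_eq (cycle_of w a) s by apply: cycle_of_perm; rewrite ?(isG_size Gw).
rewrite mem_filter mem_iota (isG_size Gw) add1n ltnS an andbT (perm_all _ pe).
by rewrite (perm_sumn (perm_map _ pe)).
Qed.

Lemma mem_Cyc_range r n w a t : isG r n w -> a \in Cyc r w t -> 0 < a <= n.
Proof.
by move=> Gw; rewrite mem_filter mem_iota (isG_size Gw) add1n ltnS => /andP[].
Qed.

(** If p+1 lies on the cycle, n+1 enters right after it: the new letter contributes -e to the color
    sum and the displaced letter +e, which cancel mod r. Any other cycle keeps its letters. *)
Lemma ucyc_bins r n p e w s : 0 < r -> p <= n -> e < r -> isG r n w -> ucyc n w s ->
  exists s', [/\ ucyc n.+1 (bins r p e w) s',
     perm_eq s' (if p.+1 \in s then n.+1 :: s else s) &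
     sumn [seq (lt_at (bins r p e w) k).2 | k <- s'] = sumn [seq (lt_at w k).2 | k <- s] %[mod r]].
Proof.
move=> r0 pn er Gw us; set w' := bins r p e w.
have old k : 0 < k <= n -> k != p.+1 -> lt_at w' k = lt_at w k.
  by case: k => // k /andP[_ kn] kp; apply: (lt_at_bins _ Gw).
case/and3P: us => cs us bs.
have bs' : all (fun k => 0 < k <= n.+1) s.
  by apply: sub_all bs => k /andP[-> /leqW].
case: ifPn => ps; last first.
  have eqs : {in s, lt_at w' =1 lt_at w}.
    move=> k ks; rewrite old ?(allP bs) //; by apply: contraNneq ps => <-.
  exists s; split => //; last by congr (sumn _ %% _); apply/eq_in_map => k ks; rewrite eqs.
  rewrite /ucyc us bs' andbT andbT.
  rewrite (@eq_in_cycle _ [in s] _ (frel (base w)) _ _ (allss _)) // => a b ain _ /=.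
  by rewrite /base eqs.
have /rot_to[i s' Ds] := ps.
have pes : perm_eq (p.+1 :: s') s by rewrite -Ds perm_rot.
have pn' : p < n by have := allP bs _ ps.
have us' : uniq (p.+1 :: s') by rewrite -Ds rot_uniq.
have /andP[ps' _] := us'.
have bs1 : all (fun k => 0 < k <= n) (p.+1 :: s') by rewrite (perm_all _ pes).
have /andP[_ bs2] := bs1.
have eqs : {in s', lt_at w' =1 lt_at w}.
  move=> k ks; rewrite old ?(allP bs2) //; by apply: contraNneq ps' => <-.
have Ep : lt_at w' p.+1 = (n.+1, negc r e) := lt_at_bins_p e Gw pn.
have En := lt_at_bins_last e Gw pn'; rewrite -/w' in En.
have pes' : perm_eq [:: p.+1, n.+1 & s'] (n.+1 :: s).
  by rewrite -(perm_cons n.+1) in pes; rewrite -(permPr pes) (perm_catCA [:: p.+1] [:: n.+1]).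
exists [:: p.+1, n.+1 & s']; split => //.
  rewrite /ucyc (perm_uniq pes') (perm_all _ pes') /= us bs' ltnSn !andbT.
  apply/andP; split; last first.
    by apply/negP=> /(allP bs); rewrite ltnn.
  apply: (@fcycle_insert _ (base w)); rewrite /base ?Ep ?En //; first by rewrite -Ds rot_cycle.
  by move=> k ks; rewrite eqs.
rewrite -(perm_sumn (perm_map _ pes)) /= Ep En /=.
have -> : [seq (lt_at w' k).2 | k <- s'] = [seq (lt_at w k).2 | k <- s'].
  by apply/eq_in_map => k ks; rewrite eqs.
rewrite /negc modnDml addnCA modnDml addnA -[_ + e + _]addnA subnKC ?(ltnW er) //.
by rewrite [_ + r]addnC -addnA modnDl.
Qed.

(** Cycles are built along the insertions: n+1 is a fixed point of the base permutation if p = n,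
    and otherwise joins the cycle of p+1. *)
Lemma ucyc_ex r n w a : 0 < r -> isG r n w -> 0 < a <= n ->
  exists2 s, ucyc n w s & a \in s.
Proof.
move=> r0; elim: n w a => [|n IH] w a; first by case: a.
move=> /(isG_binsP r0)[p [e [{}w [pn er Gw ->]]]] /andP[a0].
rewrite leq_eqVlt ltnS => /orP[/eqP->|an]; last first.
  have [s us ain] := IH _ a Gw (introT andP (conj a0 an)).
  have [s' [us' pe _]] := ucyc_bins r0 pn er Gw us.
  by exists s' => //; rewrite (perm_mem pe); case: ifP => // _; rewrite in_cons ain orbT.
case: (ltngtP p n) pn => // [pn _|Ep pn]; last first.
  exists [:: n.+1]; rewrite ?mem_head // /ucyc /= ltnSn !andbT /base.
  by rewrite -{1}Ep (lt_at_bins_p e Gw) ?Ep.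
have [s us ain] := IH _ p.+1 Gw pn.
have [s' [us' pe _]] := ucyc_bins r0 (ltnW pn) er Gw us.
by exists s' => //; rewrite (perm_mem pe) ain mem_head.
Qed.

Lemma Cyc_bins r n p e w a t : 0 < r -> p <= n -> e < r -> isG r n w ->
  (a \in Cyc r (bins r p e w) t) =
  if a == n.+1 then (p == n) && (t == negc r e) else a \in Cyc r w t.
Proof.
move=> r0 pn er Gw; have Gb := isG_bins e r0 pn Gw.
case: eqP => [->|/eqP an].
  case: (ltngtP p n) pn => // [pn|Ep] _; last first.
    have uc : ucyc n.+1 (bins r p e w) [:: n.+1].
      by rewrite /ucyc /= ltnSn !andbT /base -{1}Ep (lt_at_bins_p e Gw) ?Ep.
    rewrite (mem_Cyc _ Gb uc) ?mem_head //= leqnn /= -{1}Ep (lt_at_bins_p e Gw) ?Ep //.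
    by rewrite addn0 modn_mod eq_sym.
  have [s us ain] := ucyc_ex r0 Gw (pn : 0 < p.+1 <= n).
  have [s' [us' pe _]] := ucyc_bins r0 (ltnW pn) er Gw us.
  rewrite ain in pe; rewrite (mem_Cyc _ Gb us') ?(perm_mem pe) ?mem_head //.
  (* The cycle of n+1 contains the smaller value p+1, so n+1 is not its minimum. *)
  apply/negbTE/negP=> /andP[/allP/(_ p.+1)]; rewrite (perm_mem pe) in_cons ain orbT => /(_ isT).
  by rewrite ltnS leqNgt pn.
case: (boolP (0 < a <= n)) => [ran|ran]; last first.
  apply/idP/idP=> [/(mem_Cyc_range Gb)|/(mem_Cyc_range Gw)].
    by rewrite [a <= _]leq_eqVlt (negPf an) ltnS (negPf ran).
  by rewrite (negPf ran).
have [s us ain] := ucyc_ex r0 Gw ran.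
have [s' [us' pe E]] := ucyc_bins r0 pn er Gw us.
have ain' : a \in s' by rewrite (perm_mem pe); case: ifP; rewrite // in_cons ain orbT.
rewrite (mem_Cyc _ Gb us') // (mem_Cyc _ Gw us) // E (perm_all _ pe).
by case: ifP => //= _; case/andP: ran => _ /leqW->.
Qed.

Lemma Rmil_Cyc r n w1 w2 a t : 0 < r -> t < r ->
  isG r n w1 -> isG r n w2 -> acode w1 = bcode r w2 ->
  (a \in Rmil w1 t) = (a \in Cyc r w2 (negc r t)).
Proof.
move=> r0 tr G1 G2 E; rewrite mem_Rmil; move: n w1 w2 G1 G2 E.
apply: (acode_bcode_ind r0) => // n e u v w G1 G2 er _ IH.
have suv := isG_size G1; rewrite size_cat in suv.
have pn : size u <= n by rewrite -suv leq_addr.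
rewrite rev_cat rev_cons cat_rcons (lmin_insert (n := n)); last first.
  by rewrite -rev_cat all_rev (isG_le G1).
rewrite -rev_cat IH (Cyc_bins _ _ r0 pn er G2) eq_negc //; case: eqP => // _.
(* The suffix v is empty exactly when p = n. *)
by rewrite /nilp size_rev -suv -{1}[size u]addn0 eqn_add2l eq_sym.
Qed.

(** * First return to 1 *)

(** A letter whose base value is at most that of x decides the question, so whatever comes after it
    is irrelevant. *)
Lemma lmin_take x w k : has (fun y => y.1 <= x.1) (take k w) -> lmin x (take k w) = lmin x w.
Proof.
move=> hk; rewrite -{2}(cat_take_drop k w) lmin_cat [all _ _](_ : _ = false) ?orbF //.
by apply/allPn; case/hasP: hk => y yi yx; exists y; rewrite // -leqNgt.
Qed.

Lemma lmin_filter n a t w : a <= n -> lmin (a, t) [seq y <- w | y.1 <= n] = lmin (a, t) w.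
Proof.
move=> an; elim: w => //= y w IH; case: (leqP y.1 n) => yn /=; rewrite IH //.
rewrite (leq_ltn_trans an yn); case: eqP => // ya; by rewrite ya ltnNge an in yn.
Qed.

(** The length N is fixed in advance instead of being determined by a return, so that walks in
    different words can be compared. *)
Definition walk (r : nat) (w : word) (x : letter) (N : nat) : word :=
  traject (actG r w) (actG r w x) N.

Lemma walkS r w x N : walk r w x N.+1 = actG r w x :: walk r w (actG r w x) N.
Proof. by []. Qed.

Lemma walk_base r w x N : map fst (walk r w x N) = traject (base w) (base w x.1) N.
Proof. by rewrite /walk; elim: N x => //= N IH x; rewrite IH. Qed.

(** The cycle through 1 has at most n elements, so n steps lead back to base value 1. *)
Lemma walk_return r n w N : 0 < r -> 0 < n -> isG r n w -> n <= N ->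
  has (fun y => y.1 <= 1) (take n (walk r w (1, 0) N)).
Proof.
move=> r0 n0 Gw nN; rewrite take_traject //.
have [s us ins] := ucyc_ex r0 Gw (n0 : 0 < 1 <= n).
have [i s' Ds] := rot_to ins.
have := ucyc_size us; case/and3P: us => + _ _.
rewrite -(rot_cycle i) -(size_rot i) Ds => /fpathP[k Ek] /= sn.
have Ek' := congr1 size Ek; rewrite size_rcons size_traject in Ek'.
have: 1 \in map fst (walk r w (1, 0) n).
  rewrite walk_base; apply: (@mem_take k).
  by rewrite take_traject -?Ek' // Ek' -Ek mem_rcons mem_head.
by case/mapP=> y yi y1; apply/hasP; exists y; rewrite // -y1.
Qed.

Lemma lmin_walk r n w x N : 0 < r -> isG r n w -> 0 < n <= N -> 0 < x.1 ->
  lmin x (walk r w (1, 0) N) = lmin x (walk r w (1, 0) n).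
Proof.
move=> r0 Gw /andP[n0 nN] x0; have := walk_return r0 n0 Gw nN.
have -> : walk r w (1, 0) n = take n (walk r w (1, 0) N) by rewrite take_traject.
move=> h; rewrite lmin_take //.
by apply: sub_has h => y /leq_trans; apply.
Qed.

(** The word [orbit1] stops at the colored letter (1, 0), possibly after several turns around the
    cycle of 1. Base value 1 already occurs in the first turn and blocks everything later, so the
    first n letters decide. *)
Lemma mem_Lmic r n w a t : 0 < r -> isG r n w -> 0 < a ->
  (a \in Lmic r w t) = (0 < n) && lmin (a, t) (walk r w (1, 0) n).
Proof.
move=> r0 Gw a0.
have -> : (a \in Lmic r w t) = lmin (a, t) (orbit1 r w).
  rewrite /Lmic; set o := orbit1 r w; apply/mapP/lminP=> [[k]|[k kw [kx ak]]].
    rewrite mem_filter mem_iota add0n => /and3P[/andP[ak /eqP <-] _ ks ->].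
    by exists k => //; split=> //; case: (nth _ o k).
  exists k; last by rewrite kx.
  by rewrite mem_filter mem_iota add0n kx /= eqxx ak.
have -> : lmin (a, t) (orbit1 r w) = lmin (a, t) (walk r w (1, 0) (n * r)).
  rewrite /orbit1 (isG_size Gw).
  have -> : [seq iter k.+1 (actG r w) (1, 0) | k <- iota 0 (n * r)] = walk r w (1, 0) (n * r).
    apply: (@eq_from_nth _ (actG r w (1, 0))); rewrite size_map size_iota ?size_traject // => i ir.
    by rewrite (nth_map 0) ?size_iota // nth_iota // nth_traject // -iterSr.
  (* If (1, 0) does not occur, the truncation is all of [L]; otherwise it contains (1, 0), whose
     base value is at most a. *)
  set L := walk _ _ _ _; case: (boolP ((1, 0) \in L)) => iL; last first.
    by rewrite take_oversize // memNindex.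
  apply: lmin_take; apply/hasP; exists (1, 0) => //=.
  rewrite -[X in X \in _](nth_index (0, 0) iL).
  rewrite -[X in X \in _](@nth_take (index (1, 0) L).+1) // mem_nth //.
  by rewrite size_takel // index_mem.
case: (posnP n) => [->|n0]; first by rewrite mul0n.
by rewrite /= (lmin_walk r0 Gw) // n0 leq_pmulr.
Qed.

Lemma actG_range r n w x : isG r n w -> 0 < x.1 <= n -> 0 < (actG r w x).1 <= n.
Proof.
move=> Gw /andP[x0 xn]; have: lt_at w x.1 \in w by rewrite mem_nth // (isG_size Gw) prednK.
exact: (allP (isG_ltn Gw)).
Qed.

Lemma walk_range r n w N : isG r n w -> 0 < n -> all (fun y => y.1 <= n) (walk r w (1, 0) N).
Proof.
move=> Gw n0; have: 0 < (1, 0).1 <= n by [].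
rewrite /walk; elim: N (1, 0) => //= N IH x xn; have fn := actG_range Gw xn.
by rewrite IH // andbT; case/andP: fn.
Qed.

(** Deleting the visits to n+1 recovers the old walk: the detour from p+1 through n+1 adds -e and
    then +e to the color. The witness N' is N plus the number of these visits. *)
Lemma walk_bins r n p e w x N : 0 < r -> p <= n -> e < r -> isG r n w -> 0 < x.1 <= n ->
  exists N', [seq y <- walk r (bins r p e w) x N' | y.1 <= n] = walk r w x N.
Proof.
move=> r0 pn er Gw; elim: N x => [|N IH] x xn; first by exists 0.
have fn := actG_range Gw xn; have [N' E] := IH _ fn; have [_ fn2] := andP fn.
have [xp|xp] := eqVneq x.1 p.+1; last first.
  have gx : actG r (bins r p e w) x = actG r w x.
    by move: xn xp; rewrite /actG; case: x.1 => // k kn kp; rewrite (lt_at_bins e Gw).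
  by exists N'.+1; rewrite !walkS gx /= (fn2 : (lt_at w x.1).1 <= n) E.
have pn' : p < n by rewrite -xp; case/andP: xn.
have gx : actG r (bins r p e w) x = (n.+1, (negc r e + x.2) %% r).
  by rewrite /actG xp (lt_at_bins_p e Gw).
have ggx : actG r (bins r p e w) (actG r (bins r p e w) x) = actG r w x.
  rewrite gx /actG /= (lt_at_bins_last e Gw) //= xp; congr (_, _).
  rewrite modnDml modnDmr /negc addnCA modnDml [_ + e]addnC -addnA addnA subnK ?(ltnW er) //.
  by rewrite modnDl.
by exists N'.+2; rewrite !walkS ggx gx /= ltnn (fn2 : (lt_at w x.1).1 <= n) E.
Qed.

Lemma Lmil_walk r n w1 w2 a t : 0 < r -> t < r -> 0 < a ->
  isG r n w1 -> isG r n w2 -> acode w1 = bcode r w2 ->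
  lmin (a, t) w1 = (0 < n) && lmin (a, negc r t) (walk r w2 (1, 0) n).
Proof.
move=> r0 tr a0; move: n w1 w2; apply: (acode_bcode_ind r0) => //.
move=> n e u v w G1 G2 er _ IH.
have pn : size u <= n by rewrite -(isG_size G1) size_cat leq_addr.
have Gb := isG_bins e r0 pn G2.
rewrite (lmin_insert _ _ _ (isG_le G1)) IH [0 < n.+1]/= andTb.
case: eqP => [->|/eqP an].
  have [u0|u0] := posnP (size u).
    rewrite /nilp u0 /walk /= {1}/actG (lt_at_bins_p e G2) //.
    rewrite xpair_eqE eqxx addn0 modn_small ?negc_lt // eq_negc // eq_sym.
    by rewrite /actG /= (lt_at_bins_p e G2) //= ltnn orbF.
  case: (posnP n) => [n0|n0]; first by rewrite n0 leqNgt u0 in pn.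
  (* Position 1 is unchanged, so the walk starts with a base value at most n and n+1 cannot be a
     minimum. *)
  have fn : 0 < (actG r w (1, 0)).1 <= n by exact: (actG_range G2).
  have -> : nilp u = false by rewrite /nilp gtn_eqF.
  have gx : actG r (bins r (size u) e w) (1, 0) = actG r w (1, 0).
    by rewrite /actG (lt_at_bins e G2) // ltn_eqF.
  case/andP: fn => _ fn.
  by rewrite walkS gx; case: (actG r w (1, 0)) fn => b z /= bn; rewrite xpair_eqE ltnNge (leqW bn) ltn_eqF.
case: (ltngtP a n.+1) an => // [an _|an _]; last first.
  rewrite (lmin_gt _ (walk_range _ Gb _)) //; case: (posnP n) => //= n0.
  by rewrite (lmin_gt _ (walk_range _ G2 _)) // ltnW.
have n0 : 0 < n := leq_trans a0 an; rewrite n0 andTb.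
(* Taking n+1 letters of the old walk forces N' to be at least n+1, long enough for the new walk to
   return to 1; [lmin_walk] then exchanges the lengths N' and n+1 for n+1 and n. *)
have [N' E] := walk_bins n.+1 r0 pn er G2 (n0 : 0 < (1, 0).1 <= n).
have nN' : n.+1 <= N'.
  rewrite -(size_traject (actG r (bins r (size u) e w)) (actG r (bins r (size u) e w) (1, 0)) N').
  by rewrite -(size_traject (actG r w) (actG r w (1, 0)) n.+1) -/(walk r _ _ _) -E size_filter count_size.
rewrite -(lmin_walk (x := (a, _)) r0 Gb (nN' : 0 < n.+1 <= N') a0).
rewrite -(lmin_walk (x := (a, _)) (N := n.+1) r0 G2 _ a0) ?n0 ?leqnSn //.
by rewrite -E lmin_filter.
Qed.

Lemma Lmic_gt0 r n w a t : isG r n w -> a \in Lmic r w t -> 0 < a.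
Proof.
move=> G /mapP[k]; rewrite mem_filter mem_iota => /and3P[_ _ kw] ->.
have /mem_take/mapP[i] := mem_nth (0, 0) kw; rewrite (isG_size G) mem_iota => ir ->.
have n0 : 0 < n by case: (n) ir.
suff /andP[] : 0 < (iter i.+1 (actG r w) (1, 0)).1 <= n by [].
by elim: i.+1 => // m; rewrite iterS; exact: actG_range.
Qed.

Lemma Lmil_Lmic r n w1 w2 a t : 0 < r -> t < r ->
  isG r n w1 -> isG r n w2 -> acode w1 = bcode r w2 ->
  (a \in Lmil w1 t) = (a \in Lmic r w2 (negc r t)).
Proof.
move=> r0 tr G1 G2 E; rewrite mem_Lmil; case: (posnP a) => [a0|a0]; last first.
  by rewrite (Lmil_walk r0 tr a0 G1 G2 E) (mem_Lmic _ r0 G2 a0).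
apply/idP/idP=> [/lmin_mem/(allP (isG_ltn G1))|/(Lmic_gt0 G2)]; by rewrite a0.
Qed.

(** * Length *)

(** The formula of [sor] as a function of the code alone; applied to the A-code, it turns out to be
    the length. *)
Definition code_cost (c : seq (nat * nat)) : nat :=
  sumn [seq let j := x.1 in let c := x.2.1 in let e := x.2.2 in
            j - c + (0 < e) * (2 * (c - 1) + e)
       | x <- zip (iota 1 (size c)) c].

Definition acost (w : word) : nat := code_cost (acode w).

Lemma code_cost_rcons c p e : code_cost (rcons c (p, e)) =
  code_cost c + ((size c).+1 - p + (0 < e) * (2 * (p - 1) + e)).
Proof.
by rewrite /code_cost size_rcons iota_rcons zip_rcons ?size_iota // map_rcons sumn_rcons.
Qed.

Lemma size_acode w : size (acode w) = size w.
Proof.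
by rewrite /acode; move: {2}w => w'; elim: (size w) w' => //= n IH w'; rewrite size_rcons IH.
Qed.

Lemma size_bcode r w : size (bcode r w) = size w.
Proof.
by rewrite /bcode; move: {2}w => w'; elim: (size w) w' => //= n IH w'; rewrite size_rcons IH.
Qed.

Lemma sorE r w : sor r w = code_cost (bcode r w).
Proof. by rewrite /sor /code_cost size_bcode. Qed.

Lemma acost_insert r n e u v : isG r n (u ++ v) ->
  acost (u ++ (n.+1, e) :: v) = acost (u ++ v) + (size v + (0 < e) * (2 * size u + e)).
Proof.
move=> G; rewrite /acost (acode_insert _ G) code_cost_rcons size_acode size_cat.
by rewrite subSS addKn subSS subn0.
Qed.

(* Right multiplication by a generator: an adjacent transposition of letters,
   or an increment of the color of the first letter. *)
Inductive step (r : nat) : word -> word -> Prop :=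
| StepSwap u x y v : step r (u ++ x :: y :: v) (u ++ y :: x :: v)
| StepColor a z v : step r ((a, z) :: v) ((a, (z + 1) %% r) :: v).

Lemma step_rcons r w w' x : step r w w' -> step r (rcons w x) (rcons w' x).
Proof.
case=> [u y z v|a z v]; last exact: StepColor.
rewrite !rcons_cat; exact: StepSwap.
Qed.

Lemma step_isG r n w w' : 0 < r -> step r w w' -> isG r n w -> isG r n w'.
Proof.
move=> r0 [u x y v|a z v] G; apply: (isG_perm _ _ G).
- by rewrite !map_cat perm_cat2l (perm_catCA [:: _] [:: _]).
- by have := isG_color G; rewrite !all_cat /= => /and4P[-> -> -> ->].
- by [].
- by have := isG_color G => /= /andP[_ ->]; rewrite ltn_pmod.
Qed.

(** By induction on n, locating n+1: a step that does not involve it is a step of the word without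
    it and leaves its summand alone, while a step that involves it changes only that summand. *)
Lemma acost_step r n w w' : 0 < r -> step r w w' -> isG r n w -> acost w' <= (acost w).+1.
Proof.
move=> r0; elim: n w w' => [|n IH] w w' st G.
  by have := isG_size G; case: st {G} => // -[].
have : n.+1 \in map fst w by rewrite (mem_bases _ G) ltnSn.
case: st G => [u x y v|a z v] G /mapP[[b e] + /= En]; rewrite -{}En {b}.
  rewrite mem_cat !in_cons => /or4P[uN|/eqP xN|/eqP yN|vN].
  - case/splitPr: uN G => u1 u2; rewrite -!catA /= isG_insert => /andP[_ G].
    have G' : isG r n (u1 ++ u2 ++ y :: x :: v).
      by move: G; rewrite !catA; apply: (step_isG r0); exact: StepSwap.
    rewrite (acost_insert _ G) (acost_insert _ G') -addSn !size_cat /= leq_add2r.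
    by apply: IH G; rewrite !catA; apply: StepSwap.
  - subst x; move: (G); rewrite isG_insert => /andP[_ G1].
    have G2 : isG r n (rcons u y ++ v) by rewrite cat_rcons.
    rewrite (acost_insert _ G1) -cat_rcons (acost_insert _ G2) cat_rcons size_rcons /=.
    (* As n+1 moves one place to the right, its summand falls by 1 if e = 0 and grows by 2 - 1 = 1
       otherwise. *)
    by case: (0 < e) => /=; lia.
  - subst y; move: (G); rewrite -cat_rcons isG_insert => /andP[_ G1].
    have G2 : isG r n (u ++ x :: v) by rewrite -cat_rcons.
    rewrite (acost_insert _ G1) (acost_insert _ G2) cat_rcons size_rcons /=.
    by case: (0 < e) => /=; lia.
  case/splitPr: vN G => v1 v2; rewrite (catA u [:: x, y & v1]) isG_insert => /andP[_]; rewrite -!catA /= => G.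
  have G' : isG r n (u ++ [:: y, x & v1 ++ v2]).
    by move: G; apply: (step_isG r0); exact: StepSwap.
  rewrite (catA u [:: y, x & v1]) (catA u [:: x, y & v1]).
  rewrite !(@acost_insert r n) -?catA // -addSn !size_cat /= leq_add2r.
  by apply: IH G; apply: StepSwap.
rewrite in_cons => /predU1P[[? ?]|vN].
  subst a z; rewrite -[_ :: v]cat0s isG_insert in G; case/andP: G => er G.
  have ac c : acost ((n.+1, c) :: v) = _ := @acost_insert r n c [::] v G.
  rewrite !ac /= -!addnS !leq_add2l.
  (* At the front, the color e becomes e+1 or wraps around to 0, so the summand grows by at most
     1. *)
  by have := leq_mod (e + 1) r; case: (_ %% r) => [|c]; lia.
case/splitPr: vN G => v1 v2; rewrite -cat_cons isG_insert => /andP[_ G].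
have G' : isG r n (((a, (z + 1) %% r) :: v1) ++ v2).
  by move: G; apply: (step_isG r0); exact: StepColor.
rewrite -!cat_cons (acost_insert _ G) (acost_insert _ G') -addSn /= leq_add2r.
by apply: IH G; apply: StepColor.
Qed.

(** In the predecessor, an n+1 of positive color stands one place further left or, if already at the
    front, has its color lowered by one; an n+1 of color 0 stands one place further right. Once n+1
    is last with color 0, the descent continues in the remaining word. *)
Lemma acost_descent r n w : 0 < r -> isG r n w ->
  w = idG n /\ acost w = 0 \/
  exists w', [/\ isG r n w', step r w' w & acost w = (acost w').+1].
Proof.
move=> r0; elim: n w => [|n IH] w G; first by left; rewrite (size0nil (isG_size G)).
case/isG_splitP: G => u [[|e] [v [-> er G]]].
  case: v G => [|y v] G; last first.
    right; exists (rcons u y ++ (n.+1, 0) :: v).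
    have G' : isG r n (rcons u y ++ v) by rewrite cat_rcons.
    rewrite isG_insert er G' (acost_insert _ G) (acost_insert _ G') !cat_rcons.
    by split; [|exact: StepSwap|rewrite ltnn !mul0n !addn0 /= addnS].
  rewrite (acost_insert _ G); rewrite cats0 in G *; rewrite /= !addn0.
  case: (IH u G) => [[-> ->]|[w' [G' st Ew]]].
    by left; split; rewrite // /idG iota_rcons map_rcons cats1 add1n.
  right; exists (rcons w' (n.+1, 0)); rewrite cats1; split.
  - by rewrite -cats1 isG_insert er cats0.
  - exact: step_rcons.
  by rewrite -cats1 (@acost_insert r) cats0 // !addn0.
right; case/lastP: u G => [|u y] G.
  exists ((n.+1, e) :: v); split.
  - by rewrite -[_ :: v]cat0s isG_insert (ltnW er).
  - have -> : e.+1 = (e + 1) %% r by rewrite addn1 modn_small.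
    exact: StepColor.
  have ac c : acost ((n.+1, c) :: v) = _ := @acost_insert r n c [::] v G.
  by rewrite !ac /=; case: e er => [|e] _ /=; lia.
exists (u ++ (n.+1, e.+1) :: y :: v); rewrite cat_rcons.
have G' : isG r n (u ++ y :: v) by rewrite -cat_rcons.
split; first by rewrite isG_insert er.
  exact: StepSwap.
rewrite -[u ++ [:: y, _ & v]]cat_rcons (acost_insert _ G) (acost_insert _ G') cat_rcons size_rcons /=.
by move: (acost _) (size v) (size u) => *; lia.
Qed.

(** * The group law and products of generators *)

Lemma lt_at_color r n w k : 0 < r -> isG r n w -> (lt_at w k).2 < r.
Proof.
move=> r0 G; rewrite /lt_at; case: (ltnP k.-1 (size w)) => kw; last by rewrite nth_default.
exact: (allP (isG_color G)) (mem_nth _ kw).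
Qed.

Lemma lt_at_color0 r n w k : 0 < r -> isG r n w ->
  ((lt_at w k).1, (0 + (lt_at w k).2) %% r) = lt_at w k.
Proof. by move=> r0 G; rewrite modn_small ?(lt_at_color _ r0 G) //; case: lt_at. Qed.

Lemma map_lt_at_all w : [seq lt_at w j | j <- iota 1 (size w)] = w.
Proof. by rewrite map_lt_at ?drop0 ?take_size. Qed.

Lemma mulG_s0 r n a z v : 0 < r -> isG r n ((a, z) :: v) ->
  mulG r ((a, z) :: v) (s0 r n) = (a, (z + 1) %% r) :: v.
Proof.
move=> r0 G; have := isG_size G; rewrite /= => <-.
rewrite /mulG /= /lt_at /= modnDml addnC; congr (_ :: _); rewrite -map_comp.
have Ev : [seq lt_at ((a, z) :: v) j | j <- iota 2 (size v)] = v.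
  by rewrite map_lt_at //= drop0 take_size.
rewrite -[RHS]Ev; by apply: eq_map => k /=; rewrite (lt_at_color0 _ r0 G).
Qed.

Lemma mulG_si r n u x y v : 0 < r -> isG r n (u ++ x :: y :: v) ->
  mulG r (u ++ x :: y :: v) (si n (size u).+1) = u ++ y :: x :: v.
Proof.
move=> r0 G; have sw := isG_size G; set w := u ++ _ in G sw *.
apply: (@eq_from_nth _ (0, 0)) => [|k].
  by rewrite /mulG !size_map size_iota -sw !size_cat.
rewrite /mulG !size_map size_iota => kn.
rewrite (nth_map (0, 0)) ?size_map ?size_iota // (nth_map 0) ?size_iota // nth_iota //=.
rewrite (lt_at_color0 _ r0 G) add1n !eqSS.
case: (ltngtP k (size u)) => [ku|ku|->].
- by rewrite ltn_eqF ?leqW // /lt_at /= !nth_cat ku.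
- case: eqP => [->|/eqP ku'].
    by rewrite /lt_at /= !nth_cat ltnn ltnNge leqnSn subnn subSnn.
  rewrite /lt_at /= !nth_cat ltnNge (ltnW ku) /=.
  by have -> : k - size u = (k - (size u).+2).+2 by lia.
by rewrite /lt_at /= !nth_cat ltnn ltnNge leqnSn subnn subSnn.
Qed.

Lemma idG_isG r n : 0 < r -> isG r n (idG n).
Proof.
move=> r0; rewrite /isG size_map size_iota eqxx -map_comp map_id perm_refl /=.
by rewrite all_map; apply/allP.
Qed.

Lemma mulG_id r n w : 0 < r -> isG r n w -> mulG r w (idG n) = w.
Proof.
move=> r0 G; rewrite /mulG -map_comp -[RHS]map_lt_at_all (isG_size G).
 apply: eq_map => k /=.
by rewrite (lt_at_color0 _ r0 G).
Qed.

Lemma lt_at_id n k : 0 < k <= n -> lt_at (idG n) k = (k, 0).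
Proof.
case: k => // k /= kn; rewrite /lt_at (nth_map 0) ?size_iota //= nth_iota //.
Qed.

(** Only the ranges of the letters are assumed, so that this applies to the generators before they
    are known to lie in the group. *)
Lemma id_mulG r n w : all (fun x => (0 < x.1 <= n) && (x.2 < r)) w -> mulG r (idG n) w = w.
Proof.
move=> G; rewrite -[RHS]map_id; apply/eq_in_map => x /(allP G)/andP[xn xr].
by rewrite (lt_at_id xn) /= addn0 modn_small //; case: x {xn xr}.
Qed.

Lemma isG_id_mulG r n w : isG r n w -> mulG r (idG n) w = w.
Proof.
move=> G; apply: id_mulG; apply/allP=> x xw.
by rewrite (allP (isG_ltn G)) // (allP (isG_color G)).
Qed.

Lemma isG_mulG r n p q : 0 < r -> isG r n p -> isG r n q -> isG r n (mulG r p q).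
Proof.
move=> r0 Gp Gq; apply: (isG_perm _ _ Gp); last first.
  by rewrite all_map; apply/allP=> x _ /=; rewrite ltn_pmod.
have -> : map fst (mulG r p q) = [seq (lt_at p k).1 | k <- map fst q] by rewrite -!map_comp.
have -> : map fst p = [seq (lt_at p k).1 | k <- iota 1 n].
  by rewrite -[in LHS](map_lt_at_all p) -map_comp (isG_size Gp).
by apply: perm_map; rewrite perm_sym; case/and3P: Gq.
Qed.

Lemma mulGA r n p q s : isG r n q -> isG r n s ->
  mulG r p (mulG r q s) = mulG r (mulG r p q) s.
Proof.
move=> Gq Gs; rewrite [mulG r q s]/mulG [LHS]/mulG -map_comp; apply/eq_in_map => x xs.
have /andP[x0 xn] := allP (isG_ltn Gs) _ xs.
have -> : lt_at (mulG r p q) x.1 = ((lt_at p (lt_at q x.1).1).1,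
    ((lt_at q x.1).2 + (lt_at p (lt_at q x.1).1).2) %% r).
  by rewrite {1}/lt_at /mulG (nth_map (0, 0)) // (isG_size Gq) prednK.
by rewrite /= modnDml modnDmr addnA.
Qed.

Lemma step_gens r n w g : 0 < r -> isG r n w -> g \in gens r n -> step r w (mulG r w g).
Proof.
case: n => // n r0 G; rewrite /gens in_cons => /predU1P[->|/mapP[i + ->]].
  by have := isG_size G; case: w G => // -[a z] v G _; rewrite mulG_s0 //; exact: StepColor.
rewrite mem_iota => /andP[]; case: i => // i _; rewrite add1n ltnS => iin.
have sw := isG_size G; have iw : i.+1 < size w by rewrite sw.
move: G; rewrite -(cat_take_drop i w) (drop_nth (0, 0)) 1?ltnW // (drop_nth (0, 0)) // => G.
have si_sz : size (take i w) = i by rewrite size_takel // ltnW // ltnW.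
by rewrite -[in si _ _]si_sz mulG_si //; exact: StepSwap.
Qed.

Lemma gens_isG r n g : 0 < r -> g \in gens r n -> isG r n g.
Proof.
move=> r0 gg; have Gi := idG_isG n r0.
(* A generator is one step away from the identity, so [step_isG] places it in the group. *)
have <- : mulG r (idG n) g = g.
  apply: id_mulG; case: n gg {Gi} => // n; rewrite in_cons => /predU1P[->|/mapP[i + ->]].
    rewrite /= ltn_pmod //= all_map; apply/allP=> k.
    by rewrite mem_iota /= r0 andbT => /andP[/ltnW-> ].
  rewrite mem_iota all_map => ni; apply/allP=> k; rewrite mem_iota /= r0 andbT => kn.
  by case: eqP => [|_]; [lia | case: eqP; lia].
exact: (step_isG r0 (step_gens r0 Gi gg) Gi).
Qed.

Lemma gens_step r n w w' : 0 < r -> isG r n w -> step r w w' ->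
  exists2 g, g \in gens r n & mulG r w g = w'.
Proof.
move=> r0 G st; case: st G => [u x y v|a z v] G.
  exists (si n (size u).+1); last exact: mulG_si.
  have := isG_size G; rewrite size_cat /= !addnS => <-.
  by rewrite in_cons map_f ?orbT // mem_iota /= add1n !ltnS leq_addr.
exists (s0 r n); last exact: mulG_s0.
by have := isG_size G => /= <-; rewrite mem_head.
Qed.

Lemma prodG_isG r n ws : 0 < r -> all (fun g => g \in gens r n) ws -> isG r n (prodG r n ws).
Proof.
move=> r0; elim: ws => [|g ws IH] /=; first by move=> _; exact: idG_isG.
by case/andP=> gg aws; apply: isG_mulG (gens_isG r0 gg) (IH aws).
Qed.

(** [prodG] folds from the right whereas steps are right multiplications; associativity brings the
    last generator outside. *)
Lemma prodG_rcons r n ws g : 0 < r -> all (fun g => g \in gens r n) (rcons ws g) ->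
  prodG r n (rcons ws g) = mulG r (prodG r n ws) g.
Proof.
move=> r0; elim: ws => [|h ws IH] /=.
  by rewrite andbT => gg; rewrite mulG_id ?isG_id_mulG //; apply: gens_isG.
case/andP=> hh aw; rewrite IH // (mulGA (n := n)) //.
  by apply: prodG_isG => //; move: aw; rewrite all_rcons => /andP[].
by apply: gens_isG => //; move: aw; rewrite all_rcons => /andP[].
Qed.

Lemma acost_id n : acost (idG n) = 0.
Proof.
elim: n => // n IH; have G := idG_isG n (ltn0Sn 0).
rewrite /idG iota_rcons map_rcons -/(idG n) add1n -cats1 -[idG n]cats0 -catA.
by rewrite (@acost_insert 1) cats0 // IH.
Qed.

(** The identity has cost 0, and each appended generator raises the cost by at most one. *)
Lemma acost_prodG r n ws : 0 < r -> all (fun g => g \in gens r n) ws ->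
  acost (prodG r n ws) <= size ws.
Proof.
move=> r0; elim/last_ind: ws => [|ws g IH] aw.
  by rewrite /= acost_id.
rewrite prodG_rcons // size_rcons; move: aw; rewrite all_rcons => /andP[gg aw].
apply: leq_trans (acost_step r0 (step_gens r0 (prodG_isG r0 aw) gg) (prodG_isG r0 aw)) _.
by rewrite ltnS IH.
Qed.

(** The descents, read backwards from the identity, spell out an expression by generators. *)
Lemma acost_reached r n w : 0 < r -> isG r n w ->
  exists ws, [/\ all (fun g => g \in gens r n) ws, size ws = acost w & prodG r n ws = w].
Proof.
move=> r0; move Ec : (acost w) => c; elim: c w Ec => [|c IH] w Ec G.
  case: (acost_descent r0 G) => [[-> _]|[w' [_ _]]]; last by rewrite Ec.
  by exists [::].
case: (acost_descent r0 G) => [[_]|[w' [G' st]]]; rewrite Ec // => -[E].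
have [ws [aw sw pw]] := IH w' (esym E) G'.
have [g gg Eg] := gens_step r0 G' st.
have awg : all (fun g => g \in gens r n) (rcons ws g) by rewrite all_rcons gg.
by exists (rcons ws g); rewrite size_rcons sw (prodG_rcons r0 awg) pw.
Qed.

Lemma acost_length r n w : 0 < r -> isG r n w -> is_length r n w (acost w).
Proof.
move=> r0 G; split=> [|ws aw <-]; last exact: acost_prodG.
by have [ws [? ? ?]] := acost_reached r0 G; exists ws.
Qed.

Unset Implicit Arguments.

Theorem theorem4p1 (r n : nat) (pi : word) :
  0 < r -> isG r n pi ->
  is_length r n pi (sor r (phi r n pi)) /\
  (forall t, t < r ->
     Rmil pi t =i Cyc r (phi r n pi) (negc r t) /\
     Lmil pi t =i Lmic r (phi r n pi) (negc r t) /\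
     Lmal pi t =i Lmal (phi r n pi) (negc r t) /\
     Lmap pi t =i Lmap (phi r n pi) (negc r t)).
Proof.
move=> r0 G; have [Gphi E] := phiP r0 G.
(* [sor] depends only on the B-code, which for [phi r n pi] is the A-code of [pi]; what remains is
   that [acost] is the length. *)
split; first by rewrite sorE -E; apply: acost_length.
move=> t tr; have lmaxE i a := lmax_bcode i a r0 tr G Gphi E.
split; first by move=> a; apply: Rmil_Cyc G Gphi E.
split; first by move=> a; apply: Lmil_Lmic G Gphi E.
split=> [a|i].
  (* The same position i is a witness for both words, and for [Lmap] below the same base value a. *)
  by apply/mem_Lmal/mem_Lmal=> -[i]; rewrite (lmaxE, =^~ lmaxE) => Hi; exists i.
by apply/mem_Lmap/mem_Lmap=> -[a]; rewrite (lmaxE, =^~ lmaxE) => Hi; exists a.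
Qed.
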